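(* Let $n\ge 1$, let $\alpha,\beta>0$, and let $\lambda_1,\dots,\lambda_n>0$ and $\lambda_1^*,\dots,\lambda_n^*>0$. Let $X_1,\dots,X_n$ be independent random variables with $X_i\sim \mathrm{ENH}(\alpha,\lambda_i,\beta)$, and let $X_1^*,\dots,X_n^*$ be independent random variables with $X_i^*\sim \mathrm{ENH}(\alpha,\lambda_i^*,\beta)$, $i=1,\dots,n$. Write $X_{n:n}=\max_i X_i$ and $X^*_{n:n}=\max_i X_i^*$. If $0<\alpha\le 1$ and $(\lambda_1,\dots,\lambda_n)\stackrel{\mathrm{w}}{\succeq}(\lambda_1^*,\dots,\lambda_n^* )$, then $X_{n:n}\ge_{\mathrm{st}}X^*_{n:n}$.
   Context: For $\alpha,\lambda,\beta>0$, $X\sim \mathrm{ENH}(\alpha,\lambda,\beta)$ (exponentiated Nadarajah-Haghighi distribution) means that $X$ is a positive random variable with distribution function $[1-\exp\{1-(1+\lambda x)^{\alpha}\}]^{\beta}$ for $x>0$ (and $0$ for $x\le 0$). Weak supermajorization: for vectors $\boldsymbol{x},\boldsymbol{y}\in\mathbb{R}^n$ with increasing arrangements $x_{(1)}\le\dots\le x_{(n)}$ and $y_{(1)}\le\dots\le y_{(n)}$, $\boldsymbol{y}\stackrel{\mathrm{w}}{\succeq}\boldsymbol{x}$ (equivalently $\boldsymbol{x}\stackrel{\mathrm{w}}{\preceq}\boldsymbol{y}$) means $\sum_{i=1}^{j}x_{(i)}\ge\sum_{i=1}^{j}y_{(i)}$ for all $j=1,\dots,n$. Usual stochastic order: $X\le_{\mathrm{st}}Y$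 (equivalently $Y\ge_{\mathrm{st}}X$) means $P(X>x)\le P(Y>x)$ for all $x$. *)

(* Defs.v *)
From HB Require Import structures.
From mathcomp Require Import all_boot all_order all_algebra.
From mathcomp Require Import all_classical all_reals all_analysis.
From mathcomp Require Import measurable_realfun.

Set Implicit Arguments.
Unset Strict Implicit.
Unset Printing Implicit Defensive.

Import Order.TTheory GRing.Theory Num.Theory.
Import numFieldNormedType.Exports.

Local Open Scope classical_set_scope.
Local Open Scope ring_scope.

(* Zero-based: [ordered x j] is the (j+1)-th smallest coordinate of x. *)
Definition ordered (R : realType) (n : nat) (x : 'I_n -> R) (j : nat) : R :=
  nth 0 (sort <=%R [seq x i | i <- enum 'I_n]) j.

(* y weakly supermajorizes x. *)
Definition weak_supermaj (R : realType) (n : nat) (y x : 'I_n -> R) : Prop :=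
  forall j : nat, (1 <= j <= n)%N ->
    \sum_(i < j) ordered x i >= \sum_(i < j) ordered y i.

Definition ENH_df (R : realType) (alpha lambda beta : R) (x : R) : R :=
  if 0 < x then (1 - expR (1 - (1 + lambda * x) `^ alpha)) `^ beta else 0.

(* Positivity of X is not a separate clause: the value of the distribution
   function at 0 gives P(X <= 0) = 0. *)
Definition is_ENH (d : measure_display) (T : measurableType d) (R : realType)
    (P : probability T R) (X : {RV P >-> R}) (alpha lambda beta : R) : Prop :=
  forall x : R, cdf X x = (ENH_df alpha lambda beta x)%:E.

(* Mutual independence: the product rule on every subfamily. *)
Definition independent_RVs (d : measure_display) (T : measurableType d)
    (R : realType) (P : probability T R) (I : finType)
    (X : I -> {RV P >-> R}) : Prop :=
  forall (J : {set I}) (B : I -> set R), (forall i, measurable (B i)) ->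
    P (\bigcap_(i in [set` J]) (X i @^-1` B i)) =
    (\prod_(i in J) P (X i @^-1` B i))%E.

Section max_RV.
Context (d : measure_display) (T : measurableType d) (R : realType).
Context (P : probability T R) (n : nat) (X : 'I_n.+1 -> {RV P >-> R}).

(* The family is nonempty, so starting the iteration at [X ord0 t] only repeats
   one of the arguments of the maximum. *)
Definition max_RV (t : T) : R := \big[Num.max/X ord0 t]_(i < n.+1) X i t.

Lemma measurable_max_RV : measurable_fun setT max_RV.
Proof.
rewrite /max_RV; elim: (index_enum _) => [|i s ih].
  by under eq_fun do rewrite big_nil; exact: measurable_funPT.
under eq_fun do rewrite big_cons.
by apply: measurable_maxr => //; exact: measurable_funPT.
Qed.

HB.instance Definition _ := isMeasurableFun.Build _ _ _ _ max_RV measurable_max_RV.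

End max_RV.

(* X is smaller than Y in the usual stochastic order; only the laws matter, so
   X and Y may live on different probability spaces. *)
Definition le_st (R : realType)
    (d : measure_display) (T : measurableType d) (P : probability T R)
    (d' : measure_display) (T' : measurableType d') (Q : probability T' R)
    (X : {RV P >-> R}) (Y : {RV Q >-> R}) : Prop :=
  forall x : R, (ccdf X x <= ccdf Y x)%E.

(* Main.v *)
Require Import Defs.
From HB Require Import structures.
From mathcomp Require Import all_boot all_order all_algebra.
From mathcomp Require Import all_classical all_reals all_analysis.
From mathcomp Require Import measurable_realfun.
From mathcomp Require Import ring lra.

Set Implicit Arguments.
Unset Strict Implicit.
Unset Printing Implicit Defensive.

Import Order.TTheory GRing.Theory Num.Theory.
Import numFieldNormedType.Exports.

Local Open Scope classical_set_scope.
Local Open Scope ring_scope.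

(** By independence, the distribution function of the maximum at [x] is the
    product of the individual ones, so for [x > 0] the claim compares the
    products of [G (lambda i * x)] and [G (lambda' i * x)], where
    [G u = (1 - expR (1 - (1 + u) `^ alpha)) `^ beta].

    The function [ln \o G] is nondecreasing and concave: up to the factor
    [beta], it is the composition of [t |-> ln (1 - expR (- t))] and
    [u |-> (1 + u) `^ alpha - 1], both of which are nondecreasing and concave,
    the second one because [alpha <= 1].  A nondecreasing concave function
    summed over the coordinates reverses weak supermajorization, which is the
    required inequality.

    Concavity is only ever used as a tangent inequality
    [G u <= G v * expR (w v * (u - v))] with a nonnegative nonincreasing slope
    [w] ([ENH_df_le_tangent], [NH_slope_ge0], [NH_slope_nonincreasing]).  In this
    form it follows from [1 + x <= expR x] alone, with no second derivative.
    Taking [u] and [v] to be the sorted coordinates of the two vectors and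
    multiplying, the first product is at most [expR S] times the second, where
    [S] is the sum of [w v_i * (u_i - v_i)].  The partial sums of [u_i - v_i] are
    nonpositive by weak supermajorization, hence so is [S], by Abel summation
    ([Abel_sum_le0], [weak_supermaj_prod_le]). *)

(** * Tangent-line inequalities *)

Lemma expR_ge_tangent (R : realType) (s t : R) :
  expR t * (1 + (s - t)) <= expR s.
Proof.
rewrite -[s in leRHS](subrK t) expRD mulrC ler_wpM2r ?expR_ge0//.
exact: expR_ge1Dx.
Qed.

(** Two tangent inequalities for [expR] at the weighted mean of [ln x] and
    [ln y] add up to the claim, because their first-order terms cancel. *)
Lemma weighted_AM_GM (R : realType) (a x y : R) : 0 <= a <= 1 ->
  0 < x -> 0 < y -> x `^ a * y `^ (1 - a) <= a * x + (1 - a) * y.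
Proof.
move=> /andP[a0 a1] x0 y0; rewrite /powR !gt_eqF// -expRD.
set w := _ + _.
have hx := expR_ge_tangent (ln x) w; have hy := expR_ge_tangent (ln y) w.
rewrite !lnK ?posrE// in hx hy.
have -> : expR w = a * (expR w * (1 + (ln x - w))) +
    (1 - a) * (expR w * (1 + (ln y - w))) by rewrite /w; ring.
by apply: lerD; apply: ler_wpM2l => //; rewrite subr_ge0.
Qed.

Lemma powR_le_tangent (R : realType) (a x y : R) : 0 < a <= 1 ->
  0 < x -> 0 < y -> x `^ a <= y `^ a + a * y `^ (a - 1) * (x - y).
Proof.
move=> /andP[a0 a1] x0 y0.
have h : x `^ a * y `^ (1 - a) <= a * x + (1 - a) * y.
  by apply: weighted_AM_GM => //; rewrite ltW.
have yE : y `^ (1 - a) * y `^ (a - 1) = 1.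
  rewrite -powRD; last by rewrite (gt_eqF y0) implybT.
  by rewrite addrA subrK subrr powRr0.
have ya : y `^ a = y * y `^ (a - 1) by rewrite mulr_powRB1 ?ltW.
have -> : x `^ a = x `^ a * y `^ (1 - a) * y `^ (a - 1).
  by rewrite -mulrA yE mulr1.
have -> : y `^ a + a * y `^ (a - 1) * (x - y) =
   (a * x + (1 - a) * y) * y `^ (a - 1) by rewrite ya; ring.
by apply: ler_wpM2r => //; exact: powR_ge0.
Qed.

(** The tangent inequality at [t] for the concave function
    [ln (1 - expR (- t))], whose derivative is [(expR t - 1)^-1]; the
    exponentiated form avoids logarithms. *)
Lemma onemexpRN_le_tangent (R : realType) (s t : R) : 0 < t ->
  1 - expR (- s) <= (1 - expR (- t)) * expR ((s - t) / (expR t - 1)).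
Proof.
move=> t0.
have e1 : 0 < expR t - 1 by rewrite subr_gt0 expR_gt1.
have q0 : 0 <= 1 - expR (- t) by rewrite subr_ge0 expR_le1 oppr_le0 ltW.
have h := ler_wpM2l q0 (expR_ge1Dx ((s - t) / (expR t - 1))).
apply: le_trans h.
(* [1 - expR (- t)] is [expR (- t) * (expR t - 1)], so the claim becomes the
   tangent inequality of [expR] at [- t]. *)
have E : (1 - expR (- t)) * (1 + (s - t) / (expR t - 1)) =
    1 - expR (- t) * (1 + (- s - - t)).
  by rewrite expRN; field; rewrite ?(gt_eqF e1) ?(gt_eqF (expR_gt0 _)).
by rewrite E lerD2l lerN2; exact: expR_ge_tangent.
Qed.

(** * The exponentiated Nadarajah-Haghighi distribution function *)

(** The derivative at [u] of [ln (1 - expR (1 - (1 + u) `^ a))]. *)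
Definition NH_slope (R : realType) (a u : R) : R :=
  a * (1 + u) `^ (a - 1) / (expR ((1 + u) `^ a - 1) - 1).

Lemma powR1D_gt1 (R : realType) (a u : R) : 0 < a -> 0 < u -> 1 < (1 + u) `^ a.
Proof.
move=> a0 u0; have := gt0_ltr_powR a0 (x := 1) (y := 1 + u).
by rewrite powR1; apply; rewrite ?nnegrE; lra.
Qed.

Lemma NH_slope_ge0 (R : realType) (a u : R) : 0 < a -> 0 < u ->
  0 <= NH_slope a u.
Proof.
move=> a0 u0; rewrite /NH_slope divr_ge0//.
  by rewrite mulr_ge0 ?powR_ge0 ?ltW.
by rewrite subr_ge0 ltW// expR_gt1 subr_gt0 powR1D_gt1.
Qed.

Lemma NH_slope_nonincreasing (R : realType) (a u v : R) : 0 < a <= 1 ->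
  0 < u -> u <= v -> NH_slope a v <= NH_slope a u.
Proof.
move=> /andP[a0 a1] u0 uv; have v0 : 0 < v by exact: lt_le_trans uv.
have den w : 0 < w -> 0 < expR ((1 + w) `^ a - 1) - 1.
  by move=> w0; rewrite subr_gt0 expR_gt1 subr_gt0 powR1D_gt1.
have powN w : 0 < w -> (1 + w) `^ (a - 1) = ((1 + w) `^ (1 - a))^-1.
  by move=> w0; rewrite -powRN opprB.
have mon r : 0 <= r -> (1 + u) `^ r <= (1 + v) `^ r.
  by move=> r0; rewrite ge0_ler_powR// ?nnegrE; lra.
rewrite /NH_slope ler_pM//.
- by rewrite mulr_ge0 ?powR_ge0 ?ltW.
- by rewrite invr_ge0 ltW// den.
- rewrite !powN// ler_pM2l// lef_pV2 ?posrE ?powR_gt0 ?mon ?subr_ge0//; lra.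
- rewrite lef_pV2 ?posrE ?den// lerD2r ler_expR lerD2r mon//; exact: ltW.
Qed.

(** Composing the tangent inequalities of the two concave functions is
    legitimate because the outer one is nondecreasing. *)
Lemma NH_df_le_tangent (R : realType) (a u v : R) : 0 < a <= 1 ->
  0 < u -> 0 < v ->
  1 - expR (1 - (1 + u) `^ a) <=
  (1 - expR (1 - (1 + v) `^ a)) * expR (NH_slope a v * (u - v)).
Proof.
move=> /[dup] a01 /andP[a0 a1] u0 v0.
have t0 : 0 < (1 + v) `^ a - 1 by rewrite subr_gt0 powR1D_gt1.
have := onemexpRN_le_tangent ((1 + u) `^ a - 1) t0; rewrite !opprB.
move=> /le_trans; apply; apply: ler_wpM2l.
  by rewrite subr_ge0 expR_le1 -oppr_ge0 opprB ltW.
have -> : NH_slope a v * (u - v) = (a * (1 + v) `^ (a - 1) * (u - v)) /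
    (expR ((1 + v) `^ a - 1) - 1) by rewrite /NH_slope mulrAC.
rewrite ler_expR ler_wpM2r//.
  by rewrite invr_ge0 subr_ge0 ltW// expR_gt1.
rewrite addrA subrK lerBlDl.
have -> : u - v = (1 + u) - (1 + v) by ring.
by apply: powR_le_tangent => //; lra.
Qed.

Lemma ENH_df_ge0 (R : realType) (a l b x : R) : 0 <= ENH_df a l b x.
Proof. by rewrite /ENH_df; case: ifP => // _; exact: powR_ge0. Qed.

Lemma ENH_df_le_tangent (R : realType) (a b x l m : R) : 0 < a <= 1 -> 0 < b ->
  0 < x -> 0 < l -> 0 < m ->
  ENH_df a l b x <=
  ENH_df a m b x * expR (b * x * NH_slope a (m * x) * (l - m)).
Proof.
move=> /[dup] a01 /andP[a0 a1] b0 x0 l0 m0; rewrite /ENH_df x0.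
have q0 k : 0 < k -> 0 <= 1 - expR (1 - (1 + k * x) `^ a).
  move=> k0; rewrite subr_ge0 expR_le1 -oppr_ge0 opprB subr_ge0 ltW//.
  by rewrite powR1D_gt1// mulr_gt0.
have -> : b * x * NH_slope a (m * x) * (l - m) =
  NH_slope a (m * x) * (l * x - m * x) * b by ring.
rewrite expRM -powRM ?q0 ?expR_ge0//.
apply: ge0_ler_powR; rewrite ?nnegrE ?q0 ?mulr_ge0 ?expR_ge0 ?q0//.
  exact: ltW.
by apply: NH_df_le_tangent => //; rewrite mulr_gt0.
Qed.

(** * Weak supermajorization *)

(** Abel summation: as [w] decreases, trading the weight [w i] for the last
    weight can only increase the sum, since partial sums of [c] are nonpositive;
    what remains is a nonnegative multiple of the total sum of [c]. *)
Lemma Abel_sum_le0 (R : realDomainType) (n : nat) (w c : nat -> R) :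
  (forall i, (i < n)%N -> 0 <= w i) ->
  (forall i, (i.+1 < n)%N -> w i.+1 <= w i) ->
  (forall j, (1 <= j <= n)%N -> \sum_(i < j) c i <= 0) ->
  \sum_(i < n) w i * c i <= 0.
Proof.
case: n => [|n] w0 wD c0; first by rewrite big_ord0.
suff H : \sum_(i < n.+1) w i * c i <= w n * \sum_(i < n.+1) c i.
  by apply: le_trans H _; rewrite mulr_ge0_le0 ?w0 ?c0 ?leqnn.
elim: n {w0} wD c0 => [|n IH] wD c0; first by rewrite !big_ord1.
rewrite big_ord_recr /= [in leRHS]big_ord_recr /= mulrDr lerD2r.
apply: le_trans (IH _ _) _.
- by move=> i /ltnW; exact: wD.
- by move=> j /andP[j1 jn]; rewrite c0// j1 leqW.
- by rewrite ler_wnM2r ?c0 ?wD//= ltnS leqnSn.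
Qed.

Section ordered.
Context (R : realType) (n : nat) (x : 'I_n -> R).
Let s := sort <=%R [seq x i | i <- enum 'I_n].

Let size_s : size s = n.
Proof. by rewrite size_sort size_map size_enum_ord. Qed.

Lemma prod_ordered (F : R -> R) :
  \prod_(i < n) F (x i) = \prod_(i < n) F (ordered x i).
Proof.
transitivity (\prod_(y <- s) F y).
  by rewrite (perm_big _ (permEl (perm_sort _ _))) big_map big_enum.
by rewrite (big_nth 0) size_s big_mkord.
Qed.

Lemma ordered_le (i j : nat) : (i <= j < n)%N -> ordered x i <= ordered x j.
Proof.
move=> /andP[ij jn].
apply: (sorted_leq_nth le_trans lexx); rewrite ?inE ?size_s//.
- exact: (sort_sorted le_total).
- exact: leq_ltn_trans jn.
Qed.

Lemma ordered_gt0 (i : nat) : (forall k, 0 < x k) -> (i < n)%N ->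
  0 < ordered x i.
Proof.
move=> x0 lin; have : ordered x i \in s by rewrite mem_nth ?size_s.
by rewrite mem_sort => /mapP[k _ ->].
Qed.

End ordered.

(** A weak Karamata inequality in product form: [w v] plays the role of a
    supergradient of [ln \o F] at [v].  Multiplying the supergradient bounds
    along the sorted coordinates leaves the exponential of a sum that
    [Abel_sum_le0] shows to be nonpositive. *)
Lemma weak_supermaj_prod_le (R : realType) (n : nat) (F w : R -> R)
    (y x : 'I_n -> R) :
  (forall u, 0 <= F u) ->
  (forall u v, 0 < u -> 0 < v -> F u <= F v * expR (w v * (u - v))) ->
  (forall v, 0 < v -> 0 <= w v) ->
  (forall u v, 0 < u -> u <= v -> w v <= w u) ->
  (forall i, 0 < y i) -> (forall i, 0 < x i) -> weak_supermaj y x ->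
  \prod_(i < n) F (y i) <= \prod_(i < n) F (x i).
Proof.
move=> F0 Fw w0 wD y0 x0 yx; rewrite (prod_ordered y) (prod_ordered x).
set a := ordered y; set b := ordered x.
have step : \prod_(i < n) F (a i) <=
    \prod_(i < n) (F (b i) * expR (w (b i) * (a i - b i))).
  apply: ler_prod => i _; apply/andP; split; first exact: F0.
  by apply: Fw; apply: ordered_gt0.
apply: le_trans step _; rewrite big_split /=.
rewrite ler_piMr ?prodr_ge0// -expR_sum expR_le1.
apply: (Abel_sum_le0 (w := w \o b) (c := fun i => a i - b i)) => /=.
- by move=> i ltin; apply: w0; apply: ordered_gt0.
- move=> i ltin; apply: wD; first by apply: ordered_gt0 => //; exact: ltnW.
  by apply: ordered_le; rewrite leqnSn.
- by move=> j jn; rewrite sumrB subr_le0; exact: yx.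
Qed.

(** * Distribution of the maximum *)

Lemma cdf_max_RV (d : measure_display) (T : measurableType d) (R : realType)
    (P : probability T R) (n : nat) (X : 'I_n.+1 -> {RV P >-> R})
    (F : 'I_n.+1 -> R) (x : R) :
  independent_RVs X -> (forall i, cdf (X i) x = (F i)%:E) ->
  cdf (max_RV X : {RV P >-> R}) x = (\prod_(i < n.+1) F i)%:E.
Proof.
move=> indX XF.
have := indX [set: 'I_n.+1]%SET (fun=> `]-oo, x]%classic)
  (fun=> measurable_itv _).
under eq_bigr => i _.
  have -> : P (X i @^-1` `]-oo, x]%classic) = (F i)%:E by exact: XF.
  over.
rewrite prodEFin => PX.
have -> : \prod_(i < n.+1) F i = \prod_(i in [set: 'I_n.+1]%SET) F i.
  by apply: eq_bigl => i; rewrite inE.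
rewrite -PX /cdf /distribution /pushforward; congr (P _).
apply/seteqP; split=> t /=; rewrite in_itv /= /max_RV.
- by move=> /bigmax_leP[_ h] i _ /=; rewrite in_itv /= h.
- move=> h; apply/bigmax_leP.
  have hi i : X i t <= x by have := h i; rewrite /= in_itv inE; apply.
  by split.
Qed.

(** * Comparison of the maxima *)

Theorem theorem3p4 (R : realType)
    (d : measure_display) (T : measurableType d) (P : probability T R)
    (d' : measure_display) (T' : measurableType d') (Q : probability T' R)
    (n : nat) (alpha beta : R) (lambda lambda' : 'I_n.+1 -> R)
    (X : 'I_n.+1 -> {RV P >-> R}) (X' : 'I_n.+1 -> {RV Q >-> R})
    (alpha_gt0 : 0 < alpha) (beta_gt0 : 0 < beta)
    (lambda_gt0 : forall i, 0 < lambda i)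
    (lambda'_gt0 : forall i, 0 < lambda' i)
    (indepX : independent_RVs X)
    (X_ENH : forall i, is_ENH (X i) alpha (lambda i) beta)
    (indepX' : independent_RVs X')
    (X'_ENH : forall i, is_ENH (X' i) alpha (lambda' i) beta)
    (alpha_le1 : alpha <= 1)
    (maj : weak_supermaj lambda lambda') :
  le_st (max_RV X' : {RV Q >-> R}) (max_RV X : {RV P >-> R}).
Proof.
move=> x; rewrite !ccdf_1_cdf.
rewrite (cdf_max_RV indepX (fun i => X_ENH i x)).
rewrite (cdf_max_RV indepX' (fun i => X'_ENH i x)).
rewrite lee_fin lerD2l lerN2.
have [x0|x0] := ltP 0 x; last first.
  (* All the distribution functions vanish at a nonpositive point. *)
  by apply: ler_prod => i _; rewrite /ENH_df ltNge x0 /= lexx.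
have a01 : 0 < alpha <= 1 by rewrite alpha_gt0.
have bx0 : 0 < beta * x by rewrite mulr_gt0.
apply: (weak_supermaj_prod_le (F := fun l => ENH_df alpha l beta x)
  (w := fun l => beta * x * NH_slope alpha (l * x))) => //.
- by move=> u; exact: ENH_df_ge0.
- by move=> u v u0 v0; exact: ENH_df_le_tangent.
- by move=> v v0; rewrite mulr_ge0 ?NH_slope_ge0 ?ltW ?mulr_gt0.
- move=> u v u0 uv; rewrite ler_pM2l// NH_slope_nonincreasing ?mulr_gt0//.
  by rewrite ler_pM2r.
Qed.
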